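(* Let $\mathcal V$ be a free ultrafilter on $\mathbb N$, let $u_{\mathcal V}$ be the two-valued set function defined in the context, let $\mu_0$ be a countably additive Borel probability on $\Omega$ with $\mu_0(\{z\})=0$, let $\alpha\in(0,1)$, and suppose that $P'=\alpha u_{\mathcal V}+(1-\alpha)\mu_0$ satisfies $P'([\omega\upharpoonright n])>0$ for all $\omega\in\Omega$, $n\in\mathbb N$. If $P'$ has the CHT property, then the posteriors of $P'$ converge to the truth almost surely for every Borel event.
   Context: $\mathbb N=\{1,2,3,\dots\}$; $\Omega=\{0,1\}^{\mathbb N}$ carries the product topology, and $\mathcal B$ is its Borel $\sigma$-algebra. For $\omega\in\Omega$, $n\in\mathbb N$, $[\omega\upharpoonright n]=\{\omega':\omega'_i=\omega_i,\ 1\le i\le n\}$. Let $z=(0,0,0,\dots)$, and for $k\ge1$ let $d_k\in\Omega$ be the path with a $1$ in coordinate $k$ and $0$ in every other coordinate. A free ultrafilter on $\mathbb N$ is an ultrafilter containing no finite set. For $A\in\mathcal B$, $u_{\mathcal V}(A)=1$ if $\{k:d_k\in A\}\in\mathcal V$ and $u_{\mathcal V}(A)=0$ otherwise; this is a finitely additive probability on $\mathcal B$. For a finitely additive probability $P$ on $\mathcal B$ giving every $[\omega\upharpoonright n]$ positive probability, $P_n(A)(\omega)=P(A\cap[\omega\upharpoonright n])/P([\omega\upharpoonright n])$. CHT property of $P$: for $A\in\mathcal B$, $\delta\in(0,1)$, let $C_n(A,\delta)=\{\omega:P_n(A)(\omega)>\delta\}$ and $D_n(A,\delta)=C_n(A,\delta)\setminus\bigcup_{j<n}C_j(A,\delta)$;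 the property is that $P\big(\bigcup_{n\ge1}D_n(A,\delta)\big)=\sum_{n\ge1}P(D_n(A,\delta))$ for every $A\in\mathcal B$ and $\delta\in(0,1)$. The posteriors of $P$ converge to the truth almost surely for $A$ if $P(\{\omega:P_n(A)(\omega)\to\mathbf 1_A(\omega)\})=1$. *)

(* Defs.v *)
From mathcomp Require Import all_boot all_order all_algebra.
From mathcomp Require Import all_classical all_reals all_analysis.

Set Implicit Arguments.
Unset Strict Implicit.
Unset Printing Implicit Defensive.

Import Order.TTheory GRing.Theory Num.Theory.
Import numFieldNormedType.Exports.

Local Open Scope classical_set_scope.
Local Open Scope ring_scope.

(* Coordinates are indexed from 0: index [i] stands for the [i.+1]-st
   coordinate, and [V : set_system nat] for an ultrafilter on {1, 2, ...}
   transported along [k |-> k.+1]. Lengths [n] of initial segments are not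
   shifted, so that [n] ranges over positive numbers. *)
Notation Omega := (g_sigma_algebraType (@open cantor_space)).

Definition free_ultrafilter (V : set_system nat) : Prop :=
  UltraFilter V /\ forall S : set nat, finite_set S -> ~ V S.

Definition zero_path : Omega := fun _ : nat => false.

Definition unit_path (k : nat) : Omega := fun i : nat => i == k.

Definition cylinder (w : Omega) (n : nat) : set Omega :=
  [set w' : Omega | forall i : nat, (i < n)%N -> w' i = w i].

Definition ultra_prob (R : realType) (V : set_system nat) (A : set Omega) : R :=
  if `[< V [set k | A (unit_path k)] >] then 1 else 0.

Definition mixture (R : realType) (alpha : R) (V : set_system nat)
    (mu0 : probability Omega R) (A : set Omega) : R :=
  alpha * ultra_prob R V A + (1 - alpha) * fine (mu0 A).

(* Only the values of a set function on Borel sets are meaningful. *)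
Definition finitely_additive_probability (R : realType)
    (P : set Omega -> R) : Prop :=
  [/\ forall A, measurable A -> 0 <= P A,
      forall A B, measurable A -> measurable B -> A `&` B = set0 ->
        P (A `|` B) = P A + P B &
      P setT = 1].

Definition posterior (R : realType) (P : set Omega -> R) (A : set Omega)
    (n : nat) (w : Omega) : R :=
  P (A `&` cylinder w n) / P (cylinder w n).

Definition exceed (R : realType) (P : set Omega -> R) (A : set Omega)
    (delta : R) (n : nat) : set Omega :=
  [set w | delta < posterior P A n w].

Definition first_exceed (R : realType) (P : set Omega -> R) (A : set Omega)
    (delta : R) (n : nat) : set Omega :=
  exceed P A delta n `\`
    \bigcup_(j in [set j | (1 <= j < n)%N]) exceed P A delta j.

Definition CHT_property (R : realType) (P : set Omega -> R) : Prop :=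
  forall (A : set Omega) (delta : R), measurable A -> 0 < delta < 1 ->
    (\sum_(1 <= n < N.+1) P (first_exceed P A delta n)) @[N --> \oo]
      --> P (\bigcup_(n in [set n | (1 <= n)%N]) first_exceed P A delta n).

Definition posteriors_converge_as (R : realType) (P : set Omega -> R)
    (A : set Omega) : Prop :=
  P [set w | posterior P A n w @[n --> \oo] --> (\1_A w : R)] = 1.

Lemma ultra_prob_fap (R : realType) (V : set_system nat) :
  UltraFilter V -> finitely_additive_probability (ultra_prob R V).
Proof.
move=> UV; split.
- by move=> A _; rewrite /ultra_prob; case: ifP.
- move=> A B _ _ AB0; rewrite /ultra_prob.
  case: asboolP => VAB; case: asboolP => VA; case: asboolP => VB;
    rewrite ?addr0 ?add0r //; exfalso.
  + apply: (@filter_not_empty _ V _); apply: filterS (filterI VA VB) => k ABk.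
    by have : (A `&` B) (unit_path k) by []; rewrite AB0.
  + have [//|VnA] := @in_ultra_setVsetC _ V [set k | A (unit_path k)] UV.
    by apply: VB; apply: filterS (filterI VAB VnA) => k [[]].
  + by apply: VAB; apply: filterS VA => k; left.
  + by apply: VAB; apply: filterS VA => k; left.
  + by apply: VAB; apply: filterS VB => k; right.
- rewrite /ultra_prob; case: asboolP => // -[]; exact: filterT.
Qed.

Lemma mixture_fap (R : realType) (alpha : R) (V : set_system nat)
    (mu0 : probability Omega R) :
  UltraFilter V -> 0 < alpha < 1 ->
  finitely_additive_probability (mixture alpha V mu0).
Proof.
move=> UV /andP[a0 a1]; have [u0 uD uT] := ultra_prob_fap R UV.
split.
- move=> A mA; apply: addr_ge0; apply: mulr_ge0.
  + exact: ltW.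
  + exact: u0.
  + by rewrite subr_ge0 ltW.
  + exact: fine_ge0.
- move=> A B mA mB AB0; rewrite /mixture uD// measureU//.
  rewrite fineD ?fin_num_measure//.
  by rewrite !mulrDr addrACA.
- by rewrite /mixture uT probability_setT/= !mulr1 addrC subrK.
Qed.

(* Main.v *)
(* Off [z] the ultrafilter part gives no mass to small cylinders, so there the
   posteriors of [P'] are eventually those of [mu0], which converge [mu0]-almost
   surely by Levy's zero-one law. Levy's law follows from the maximal inequality
   [delta * mu (sup_n mu(B | [w|n]) > delta) <= mu B], applied to the symmetric
   difference [B] of the event and a finite union of cylinders close to it. It
   remains to treat [d_k] for [V]-many [k]; there convergence holds as soon as
   [mu0 {d_k} > 0], since almost sure convergence cannot fail at an atom. The CHT
   property for [z|m] \ {d_1, d_2, ...} with [m] large and [delta = 1/2] forces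
   [V]-many [d_k] to be atoms of [mu0]. *)

Require Import Defs.
From mathcomp Require Import all_boot all_order all_algebra.
From mathcomp Require Import all_classical all_reals all_analysis.

Import Order.TTheory GRing.Theory Num.Theory.
Import numFieldNormedType.Exports.

Local Open Scope classical_set_scope.
Local Open Scope ring_scope.

(** * Cylinders as a base of the product topology *)

Lemma cylinder_refl (w : Omega) (n : nat) : cylinder w n w.
Proof. by []. Qed.

Lemma cylinder_eq (w w' : Omega) (n : nat) :
  cylinder w n w' -> cylinder w' n = cylinder w n.
Proof.
by move=> ww'; apply/seteqP; split => v vP i lin; rewrite vP ?ww'// -ww'.
Qed.

Lemma cylinder_le (w : Omega) (m n : nat) :
  (m <= n)%N -> cylinder w n `<=` cylinder w m.
Proof. by move=> mn v vP i lim; apply: vP; exact: leq_trans mn. Qed.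

Lemma open_cylinder (w : Omega) (n : nat) :
  @open cantor_space (cylinder w n).
Proof.
elim: n => [|n IH].
  by rewrite (_ : cylinder w 0 = setT);
    [exact: (@openT cantor_space) | exact/seteqP].
rewrite (_ : cylinder w n.+1 =
    cylinder w n `&` (@proj nat (fun=> bool) n) @^-1` [set w n]).
  apply: openI => //; apply: open_comp => [v _|]; first exact: proj_continuous.
  exact: discrete_open.
apply/seteqP; split => v.
  by move=> vP; split; [exact: cylinder_le vP | exact: vP].
by move=> [vP vn] i; rewrite ltnS leq_eqVlt => /predU1P[->//|]; exact: vP.
Qed.

Lemma measurable_open (U : set Omega) : @open cantor_space U -> measurable U.
Proof. exact: sub_sigma_algebra. Qed.

Lemma measurable_cylinder (w : Omega) (n : nat) : measurable (cylinder w n).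
Proof. by apply: measurable_open; exact: open_cylinder. Qed.

(** Membership in the [n]-th algebra of the filtration: such an [E] is a union of cylinders of
    length [n]. *)
Definition determined_by (n : nat) (E : set Omega) : Prop :=
  forall w, E w -> cylinder w n `<=` E.

Lemma measurable_determined_by (n : nat) (E : set Omega) :
  determined_by n E -> measurable E.
Proof.
move=> En; apply: measurable_open.
rewrite (_ : E = \bigcup_(w in E) cylinder w n).
  by apply: bigcup_open => w _; exact: open_cylinder.
by apply/seteqP; split => [w Ew|w [v /En + /=]]; [exists w|exact].
Qed.


(** Otherwise a point outside [U] can be picked in every [cylinder w n]. The coordinate [i] of this
    sequence equals [w i] from stage [i.+1] on, so the sequence converges to [w] and must enter the
    open set [U]. *)
Lemma open_cylinder_sub (U : set Omega) (w : Omega) :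
  @open cantor_space U -> U w -> exists n, cylinder w n `<=` U.
Proof.
move=> oU Uw; apply: contrapT => /forallNP noU.
have /choice[v vP] n : exists v, cylinder w n v /\ ~ U v.
  by have /existsNP[v /not_implyP] := noU n; exists v.
have vw : (v : nat -> cantor_space) @ \oo --> (w : cantor_space).
  apply/cvg_sup => i; apply/cvg_image.
    by apply/seteqP; split => // b _; exists (fun=> b).
  move=> Q /nbhs_singleton Qw; exists ((fun f : nat -> bool => f i) @^-1` Q).
    exists i.+1 => // n /= ni; rewrite -[v n i]/(v n i) (vP n).1//.
  apply/seteqP; split => [b [f ? <-]//|b Qb].
  by exists (fun=> b).
have : nbhs (w : cantor_space) U by apply: open_nbhs_nbhs.
by move=> /vw[n _ /(_ n (leqnn n))]; exact: (vP n).2.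
Qed.

(** * Finitely additive probabilities; continuity of countably additive ones *)

Definition real_prob {R : realType} (mu : probability Omega R)
    (A : set Omega) : R := fine (mu A).

Lemma real_prob_fap (R : realType) (mu : probability Omega R) :
  finitely_additive_probability (real_prob mu).
Proof.
split=> [A _|A B mA mB AB0|]; rewrite /real_prob.
- exact: fine_ge0.
- by rewrite measureU// fineD ?fin_num_measure.
- by rewrite probability_setT.
Qed.

Section finitely_additive.
Context {R : realType} {P : set Omega -> R}.
Hypothesis fapP : finitely_additive_probability P.

Lemma fap_ge0 (A : set Omega) : measurable A -> 0 <= P A.
Proof. by case: fapP => + _ _; exact. Qed.

Lemma fap_setDI (A B : set Omega) : measurable A -> measurable B ->
  P A = P (A `&` B) + P (A `\` B).
Proof.
move=> mA mB; have [_ <- //] := fapP; first by rewrite setUIDK.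
- exact: measurableI.
- exact: measurableD.
- by apply/seteqP; split => // w [[_ Bw] [_]].
Qed.

Lemma fap_set0 : P set0 = 0.
Proof.
have [_ + _] := fapP => /(_ _ _ measurable0 measurable0 (setI0 _)).
by rewrite setU0 => /eqP; rewrite addrC -subr_eq subrr => /eqP.
Qed.

Lemma fap_le (A B : set Omega) : measurable A -> measurable B ->
  A `<=` B -> P A <= P B.
Proof.
move=> mA mB AB; rewrite (fap_setDI B A)// (setIidr AB) lerDl fap_ge0//.
exact: measurableD.
Qed.

Lemma fap_leU (A B : set Omega) : measurable A -> measurable B ->
  P (A `|` B) <= P A + P B.
Proof.
move=> mA mB; rewrite (fap_setDI (A `|` B) A)//; last exact: measurableU.
rewrite (setIidr (@subsetUl _ A B)) lerD2l fap_le//; last by move=> w [[]].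
by apply: measurableD => //; exact: measurableU.
Qed.

End finitely_additive.

Section continuity.
Context {R : realType} (mu : probability Omega R).

Lemma real_prob_nondecreasing (F : nat -> set Omega) :
  (forall n, measurable (F n)) -> {homo F : m n / (m <= n)%N >-> m `<=` n} ->
  real_prob mu (F n) @[n --> \oo] --> real_prob mu (\bigcup_n F n).
Proof.
move=> mF ndF; apply: fine_cvg; rewrite fineK ?fin_num_measure//; last first.
  exact: bigcup_measurable.
apply: nondecreasing_cvg_mu => //; first exact: bigcup_measurable.
by move=> m n mn; apply/subsetPset; exact: ndF.
Qed.

Lemma real_prob_nonincreasing (F : nat -> set Omega) :
  (forall n, measurable (F n)) -> {homo F : m n / (m <= n)%N >-> n `<=` m} ->
  real_prob mu (F n) @[n --> \oo] --> real_prob mu (\bigcap_n F n).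
Proof.
move=> mF niF; apply: fine_cvg; rewrite fineK ?fin_num_measure//; last first.
  exact: bigcap_measurable.
apply: nonincreasing_cvg_mu => //; last 2 first.
- exact: bigcap_measurable.
- by move=> m n mn; apply/subsetPset; exact: niF.
- by rewrite ltey_eq fin_num_measure.
Qed.

Lemma real_prob_sigma_additive (F : nat -> set Omega) :
  (forall n, measurable (F n)) -> trivIset setT F ->
  (\sum_(0 <= n < N) real_prob mu (F n)) @[N --> \oo]
    --> real_prob mu (\bigcup_n F n).
Proof.
move=> mF tF; have mUF : measurable (\bigcup_n F n) by exact: bigcup_measurable.
rewrite (_ : (fun N => _) = fine \o (fun N => (\sum_(0 <= n < N) mu (F n))%E)).
  apply: fine_cvg; rewrite fineK ?fin_num_measure//.
  exact: measure_semi_sigma_additive.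
apply/funext => N /=; rewrite sum_fine// => i _; exact: fin_num_measure.
Qed.

End continuity.

(** * Approximation of Borel sets by finite unions of cylinders *)

Lemma determined_by_le (m n : nat) (E : set Omega) :
  (m <= n)%N -> determined_by m E -> determined_by n E.
Proof. by move=> mn Em w /Em; apply: subset_trans; exact: cylinder_le. Qed.

Lemma determined_byC (n : nat) (E : set Omega) :
  determined_by n E -> determined_by n (~` E).
Proof.
move=> En w nEw v wv Ev; apply/nEw/(En _ Ev).
by rewrite (cylinder_eq _ _ _ wv); exact: cylinder_refl.
Qed.

Lemma determined_byU (n : nat) (E F : set Omega) :
  determined_by n E -> determined_by n F -> determined_by n (E `|` F).
Proof. by move=> En Fn w [/En|/Fn] wP v /wP; [left|right]. Qed.

Section approximation.
Context {R : realType} (mu : probability Omega R).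
Let p := real_prob mu.
Let fap_p : finitely_additive_probability p := real_prob_fap R mu.

(** The good sets for a sigma-algebra argument: the class is closed under complements and countable
    unions and contains the open sets. *)
Definition approximable (A : set Omega) : Prop :=
  measurable A /\ forall e : R, 0 < e ->
    exists n E, determined_by n E /\ p (A `+` E) < e.

Let measurableY (A B : set Omega) :
  measurable A -> measurable B -> measurable (A `+` B).
Proof. by move=> mA mB; apply: measurableU; exact: measurableD. Qed.

Lemma approximable_determined_by (n : nat) (E : set Omega) :
  determined_by n E -> approximable E.
Proof.
move=> En; split=> [|e e0]; first exact: measurable_determined_by En.
by exists n, E; rewrite setYK (fap_set0 fap_p).
Qed.

Lemma approximableC (A : set Omega) : approximable A -> approximable (~` A).
Proof.
move=> [mA AP]; split=> [|e /AP[n [E [En AE]]]]; first exact: measurableC.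
exists n, (~` E); split; first exact: determined_byC.
suff -> : ~` A `+` ~` E = A `+` E by [].
by rewrite /setY !setDE !setCK setUC ![~` _ `&` _]setIC.
Qed.

Lemma approximableU (A B : set Omega) :
  approximable A -> approximable B -> approximable (A `|` B).
Proof.
move=> [mA AP] [mB BP]; split=> [|e e0]; first exact: measurableU.
have e20 : 0 < e / 2 by rewrite divr_gt0.
have [m [E [Em AE]]] := AP _ e20; have [n [F [Fn BF]]] := BP _ e20.
have mE := measurable_determined_by _ _ Em.
have mF := measurable_determined_by _ _ Fn.
exists (maxn m n), (E `|` F); split.
  apply: determined_byU.
    by apply: determined_by_le Em; exact: leq_maxl.
  by apply: determined_by_le Fn; exact: leq_maxr.
apply: (@le_lt_trans _ _ (p ((A `+` E) `|` (B `+` F)))).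
  apply: (fap_le fap_p).
  - by apply: measurableY; exact: measurableU.
  - by apply: measurableU; exact: measurableY.
  - move=> w [[[Aw|Bw] /not_orP[nE nF]]|[[Ew|Fw] /not_orP[nA nB]]].
    + by left; left.
    + by right; left.
    + by left; right.
    + by right; right.
apply: le_lt_trans (fap_leU fap_p _ _ _ _) _; try exact: measurableY.
by rewrite (splitr e) ltrD.
Qed.

(** The part [D n] of the union missed by the first [n] sets decreases to the empty set, so some
    [D N] has measure below [e / 2]; the finite union [B N] is approximated within the other
    half. *)
Lemma approximable_bigcup (A : nat -> set Omega) :
  (forall n, approximable (A n)) -> approximable (\bigcup_n A n).
Proof.
move=> AP; pose B n := \bigcup_(i < n) A i.
have BP n : approximable (B n).
  rewrite /B bigcup_mkord; elim/big_ind : _ => //.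
  - by apply: (approximable_determined_by 0) => ? [].
  - exact: approximableU.
have mUA : measurable (\bigcup_n A n) by apply: bigcup_measurable => n _; case: (AP n).
split=> // e e0; have e20 : 0 < e / 2 by rewrite divr_gt0.
pose D n := \bigcup_n A n `\` B n.
have mD n : measurable (D n) by apply: measurableD => //; case: (BP n).
have : p (D n) @[n --> \oo] --> (0 : R).
  rewrite -(fap_set0 fap_p) (_ : set0 = \bigcap_n D n).
    apply: real_prob_nonincreasing => // m n mn w [Aw nBw]; split=> // -[i im Ai].
    by apply: nBw; exists i => //=; exact: leq_trans im mn.
  apply/esym/seteqP; split=> // w Dw.
  have [[i _ Ai] _] := Dw 0%N I; have [_ []] := Dw i.+1 I.
  by exists i => /=.
move=> /cvgr_lt /(_ _ e20) [N _ /(_ N (leqnn N))/= DN].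
have [mB /(_ _ e20)[n [E [En BE]]]] := BP N.
have mE := measurable_determined_by _ _ En.
exists n, E; split => //.
apply: (@le_lt_trans _ _ (p (D N `|` (B N `+` E)))).
  apply: (fap_le fap_p).
  - exact: measurableY.
  - by apply: measurableU => //; exact: measurableY.
  - move=> w [[Aw nEw]|[Ew nAw]].
      by have [Bw|nBw] := pselect (B N w); [right; left|left; split].
    right; right; split => // -[i _ Ai].
    by apply: nAw; exists i.
apply: le_lt_trans (fap_leU fap_p _ _ _ _) _ => //; first exact: measurableY.
by rewrite (splitr e) ltrD.
Qed.

Lemma measurable_approximable (A : set Omega) :
  measurable A -> approximable A.
Proof.
move=> mA; apply: (smallest_sub _ _ mA).
  split.
  - by apply: (approximable_determined_by 0) => ? [].
  - by move=> B; rewrite setTD; exact: approximableC.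
  - exact: approximable_bigcup.
(* An open set is the union over [n] of the sets of points whose cylinder of length [n] fits inside
   it, and each of these is determined by [n]. *)
move=> U oU; pose F n := [set w | cylinder w n `<=` U].
rewrite (_ : U = \bigcup_n F n).
  apply: approximable_bigcup => n; apply: (approximable_determined_by n).
  by move=> w Uw v wv; rewrite /F /= (cylinder_eq _ _ _ wv).
apply/seteqP; split=> [w|w [n _]]; last by apply; exact: cylinder_refl.
by move=> /(open_cylinder_sub _ _ oU)[n wU]; exists n.
Qed.

End approximation.

(** * The maximal inequality for posteriors *)

Definition fork (w : Omega) (m : nat) (b : bool) : Omega :=
  fun i => if i == m then b else w i.

Lemma cylinder_fork (w : Omega) (m : nat) :
  cylinder w m =
  cylinder (fork w m true) m.+1 `|` cylinder (fork w m false) m.+1.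
Proof.
apply/seteqP; split=> [v vP|v [] vP i im]; last 2 first.
- by rewrite (vP i (ltnW im)) /fork ltn_eqF.
- by rewrite (vP i (ltnW im)) /fork ltn_eqF.
- have [vm|vm] := boolP (v m); [left|right] => i; rewrite ltnS leq_eqVlt /fork;
    case: eqVneq => [->//|_ /= /vP//].
  by move/negbTE: vm.
Qed.

Lemma disjoint_fork (w : Omega) (m : nat) :
  cylinder (fork w m true) m.+1 `&` cylinder (fork w m false) m.+1 = set0.
Proof.
apply/seteqP; split=> // v [/(_ m (ltnSn m)) + /(_ m (ltnSn m))].
by rewrite /fork eqxx => ->.
Qed.

(** The posterior at stage [n] sees [w] only through its cylinder of length [n]. Hence [Y] may be
    arbitrary and the event is still Borel. *)
Lemma determined_by_posterior (R : realType) (P : set Omega -> R)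
    (A : set Omega) (n : nat) (Y : set R) :
  determined_by n [set w | Y (posterior P A n w)].
Proof. by move=> w Yw v wv; rewrite /posterior /= (cylinder_eq _ _ _ wv). Qed.

Lemma measurable_exceed (R : realType) (P : set Omega -> R) (A : set Omega)
    (delta : R) (n : nat) : measurable (exceed P A delta n).
Proof.
apply: measurable_determined_by.
exact: (determined_by_posterior _ P A n [set x | delta < x]).
Qed.

Section maximal_inequality.
Context {R : realType} (delta : R) (delta0 : 0 <= delta).

(* On a cylinder of length [m] either the ratio already exceeds [delta], or the
   inequality follows by adding those for its two halves. *)
Lemma maximal_inequality_cylinder (P : set Omega -> R)
    (fapP : finitely_additive_probability P) (A : set Omega)
    (mA : measurable A) (j m : nat) (w : Omega) :
  delta * P ((\bigcup_(i in [set i | (m <= i <= m + j)%N]) exceed P A delta i)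
             `&` cylinder w m)
  <= P (A `&` cylinder w m).
Proof.
elim: j m w => [|j IH] m w; set M := \bigcup_(_ in _) _.
all: have mM : measurable M
  by apply: bigcup_measurable => i _; exact: measurable_exceed.
all: have mC v k := measurable_cylinder v k.
all: have mX X v k : measurable X -> measurable (X `&` cylinder v k)
  by move=> mX; exact: measurableI.
all: have [wm|wm] := pselect (exceed P A delta m w).
1,3: have: delta * P (cylinder w m) <= P (A `&` cylinder w m).
(* On a cylinder of probability [0] the quotient is [0] by the convention on inverses, so it cannot
   exceed [delta >= 0]; elsewhere the denominator can be multiplied out. *)
1,3: move: wm; rewrite /exceed /posterior /=;
  have := fap_ge0 fapP _ (mC w m); rewrite le_eqVlt => /predU1P[<-|C0];
  [by rewrite invr0 mulr0 ltNge delta0 | by rewrite ltr_pdivlMr// => /ltW].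
1,2: apply: le_trans; rewrite ler_wpM2l// (fap_le fapP)//; exact: mX.
- rewrite (_ : M `&` _ = set0).
    by rewrite (fap_set0 fapP) mulr0 (fap_ge0 fapP)//; exact: mX.
  apply/seteqP; split => // v [[i /=]].
  rewrite addn0 -eqn_leq => /eqP <- + wv; rewrite /exceed /posterior /=.
  by rewrite (cylinder_eq _ _ _ wv).
- have splitE X : measurable X -> P (X `&` cylinder w m) =
      P (X `&` cylinder (fork w m true) m.+1) +
      P (X `&` cylinder (fork w m false) m.+1).
    move=> mX'; rewrite cylinder_fork setIUr; have [_ + _] := fapP; apply.
    + exact: mX.
    + exact: mX.
    + by rewrite setIACA setIid disjoint_fork setI0.
  pose M' := \bigcup_(i in [set i | (m.+1 <= i <= m.+1 + j)%N]) exceed P A delta i.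
  have mM' : measurable M'
    by apply: bigcup_measurable => i _; exact: measurable_exceed.
  have -> : M `&` cylinder w m = M' `&` cylinder w m.
    apply/seteqP; split => v [[i /= /andP[mi ij] iv] wv]; split => //; exists i => //=.
      rewrite addSnnS ij andbT ltn_neqAle mi andbT; apply/eqP => mE.
      by move: iv; rewrite -mE /exceed /posterior /= (cylinder_eq _ _ _ wv).
    by rewrite (ltnW mi) -addSnnS.
  by rewrite !splitE// mulrDr lerD// IH.
Qed.

(** The inequality on the cylinder of length [0], which is the whole space, is uniform in the number
    of stages, so continuity from below passes it to the limit. *)
Lemma maximal_inequality (mu : probability Omega R) (A : set Omega) :
  measurable A ->
  delta * real_prob mu (\bigcup_n exceed (real_prob mu) A delta n)
  <= real_prob mu A.
Proof.
move=> mA; pose M n := \bigcup_(i in [set i | (0 <= i <= n)%N])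
  exceed (real_prob mu) A delta i.
have -> : \bigcup_n exceed (real_prob mu) A delta n = \bigcup_n M n.
  apply/seteqP; split=> w [n _]; first by exists n => //; exists n => //=.
  by move=> [i _ iw]; exists i.
have cM : delta * real_prob mu (M n) @[n --> \oo] -->
    delta * real_prob mu (\bigcup_n M n).
  apply: cvgMr; apply: real_prob_nondecreasing => [n|m n mn w [i /= im iw]].
    by apply: bigcup_measurable => i _; exact: measurable_exceed.
  by exists i => //=; exact: leq_trans mn.
apply: (cvgr_to_le cM); near=> n.
have := maximal_inequality_cylinder _ (real_prob_fap R mu) _ mA n 0 (fun=> false).
have -> : cylinder (fun=> false) 0 = setT by exact/seteqP.
by rewrite !setIT add0n.
Unshelve. all: by end_near.
Qed.

End maximal_inequality.

(** * Levy's zero-one law *)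

Definition deviation (R : realType) (P : set Omega -> R) (A : set Omega)
    (e : R) (n : nat) : set Omega :=
  [set w | e < `|posterior P A n w - \1_A w|].

Lemma measurable_deviation (R : realType) (P : set Omega -> R)
    (A : set Omega) (e : R) (n : nat) :
  measurable A -> measurable (deviation R P A e n).
Proof.
move=> mA.
have mY (Y : set R) : measurable [set w | Y (posterior P A n w)].
  by apply: measurable_determined_by; exact: determined_by_posterior.
rewrite (_ : deviation _ _ _ _ _ =
    (A `&` [set w | [set x : R | e < `|x - 1|] (posterior P A n w)]) `|`
    (~` A `&` [set w | [set x : R | e < `|x|] (posterior P A n w)])).
  apply: measurableU; first exact: measurableI.
  by apply: measurableI => //; exact: measurableC.
apply/seteqP; split => w; rewrite /deviation /= indicE.
  by have [Aw|Aw] := pselect (A w);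
    [rewrite mem_set//; left|rewrite memNset// subr0; right].
by move=> [[Aw]|[Aw]]; [rewrite mem_set|rewrite memNset// subr0].
Qed.

(** Tolerances [k.+1%:R^-1] suffice to test convergence; the countable description yields
    measurability and lets null sets be treated one tolerance at a time. *)
Lemma posterior_cvgE (R : realType) (P : set Omega -> R) (A : set Omega) :
  [set w | posterior P A n w @[n --> \oo] --> (\1_A w : R)] =
  ~` \bigcup_k lim_sup_set (deviation R P A k.+1%:R^-1).
Proof.
apply/seteqP; split=> w /=.
  move=> /cvgrPdist_le wc [k _ wk].
  have /wc[N _ NP] : (0 : R) < k.+1%:R^-1 by [].
  have [n /= Nn] := wk N I; rewrite /deviation /= distrC ltNge.
  by rewrite NP.
move=> wk; apply/cvgrPdist_le => e e0.
have [k ke] : exists k : nat, k.+1%:R^-1 < e.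
  have [k _ /(_ k (leqnn k))] := near_infty_natSinv_lt (PosNum e0).
  by exists k.
apply: contrapT => nwe; apply: wk; exists k => // N _.
apply: contrapT => nN; apply: nwe; exists N => // n /= Nn.
rewrite distrC leNgt; apply/negP => ewn; apply: nN; exists n => //=.
exact: lt_trans ewn.
Qed.

Lemma measurable_lim_sup_deviation (R : realType) (P : set Omega -> R)
    (A : set Omega) (e : R) :
  measurable A -> measurable (lim_sup_set (deviation R P A e)).
Proof.
move=> mA; apply: bigcap_measurable => // n _; apply: bigcup_measurable => k _.
exact: measurable_deviation.
Qed.

Lemma measurable_posterior_cvg (R : realType) (P : set Omega -> R)
    (A : set Omega) : measurable A ->
  measurable [set w | posterior P A n w @[n --> \oo] --> (\1_A w : R)].
Proof.
move=> mA; rewrite posterior_cvgE; apply: measurableC.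
by apply: bigcup_measurable => k _; exact: measurable_lim_sup_deviation.
Qed.

Lemma deviation_le (R : realType) (P : set Omega -> R) (A E : set Omega)
    (e : R) (n : nat) :
  finitely_additive_probability P -> (forall w, 0 < P (cylinder w n)) ->
  measurable A -> determined_by n E ->
  deviation R P A e n `<=` (A `+` E) `|` exceed P (A `+` E) e n.
Proof.
move=> fapP P0 mA En w.
have mE := measurable_determined_by _ _ En.
have mC := measurable_cylinder w n.
have mY : measurable (A `+` E) by apply: measurableU; exact: measurableD.
have mI X : measurable X -> measurable (X `&` cylinder w n).
  by move=> mX; exact: measurableI.
have post_ge0 X : measurable X -> 0 <= posterior P X n w.
  by move=> mX; rewrite /posterior divr_ge0// (fap_ge0 fapP)//; exact: mI.
have post_le X Y : measurable X -> measurable Y ->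
    X `&` cylinder w n `<=` Y -> posterior P X n w <= posterior P Y n w.
  move=> mX mY' XY; rewrite /posterior ler_pM2r ?invr_gt0//.
  rewrite (fap_le fapP)//; [exact: mI|exact: mI|].
  by move=> v Xv; split; [exact: XY|case: Xv].
have [Yw|nYw] := pselect ((A `+` E) w); first by left.
move=> dw; right; apply: lt_le_trans dw _.
have [Ew|nEw] := pselect (E w).
  have Aw : A w by apply: contrapT => nAw; apply: nYw; right.
  rewrite indicE mem_set//.
  have -> : posterior P A n w = 1 - posterior P (~` A) n w.
    rewrite /posterior -[1](divff (lt0r_neq0 (P0 w))) -mulrBl.
    rewrite [P (cylinder w n)](fap_setDI fapP _ A)// setDE setIC.
    by rewrite [~` A `&` _]setIC addrK.
  rewrite addrAC subrr add0r normrN ger0_norm ?post_ge0//; last exact: measurableC.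
  apply: post_le => //; first exact: measurableC.
  by move=> v [nAv wv]; right; split => //; exact: En wv.
have nAw : ~ A w by move=> Aw; apply: nYw; left.
rewrite indicE memNset// subr0 ger0_norm ?post_ge0//.
apply: post_le => // v [Av wv]; left; split => //.
exact: determined_byC En _ nEw _ wv.
Qed.

(* Levy's zero-one law for the filtration generated by the cylinders. *)
Lemma posterior_cvg_ae (R : realType) (mu : probability Omega R)
    (A : set Omega) :
  (forall w n, 0 < real_prob mu (cylinder w n)) -> measurable A ->
  mu (~` [set w | posterior (real_prob mu) A n w @[n --> \oo]
                    --> (\1_A w : R)]) = 0%E.
Proof.
move=> mu0 mA; rewrite posterior_cvgE setCK.
have fap_mu := real_prob_fap R mu.
suff dev0 e : 0 < e ->
    real_prob mu (lim_sup_set (deviation R (real_prob mu) A e)) = 0.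
  apply: measure_negligible.
    by apply: bigcup_measurable => k _; exact: measurable_lim_sup_deviation.
  apply: negligible_bigcup => k; apply/negligibleP.
    exact: measurable_lim_sup_deviation.
  rewrite -[LHS]fineK ?fin_num_measure//; last exact: measurable_lim_sup_deviation.
  by congr EFin; exact: dev0.
move=> e0; have mL := measurable_lim_sup_deviation R (real_prob mu) A e mA.
apply/eqP; rewrite eq_le (fap_ge0 fap_mu)// andbT.
apply/ler_addgt0Pl => /= d d0; rewrite addr0.
have [_ AP] := measurable_approximable mu A mA.
(* The bound below is the measure of the symmetric difference plus, by the maximal inequality, at
   most [e^-1] times it; accuracy [d / (1 + e^-1)] makes the total at most [d]. *)
have e1 : 0 < 1 + e^-1 by rewrite addr_gt0// invr_gt0.
have [N [E [EN AE]]] := AP _ (divr_gt0 d0 e1).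
have mE := measurable_determined_by _ _ EN.
have mY : measurable (A `+` E) by apply: measurableU; exact: measurableD.
have mX : measurable (\bigcup_n exceed (real_prob mu) (A `+` E) e n).
  by apply: bigcup_measurable => n _; exact: measurable_exceed.
apply: le_trans (_ : real_prob mu ((A `+` E) `|`
    \bigcup_n exceed (real_prob mu) (A `+` E) e n) <= _).
  rewrite (fap_le fap_mu)//; first exact: measurableU.
  (* A point of the limit superior deviates at some stage [n >= N], where [E] is still determined by
     [n]. *)
  move=> w /(_ N I)[n /= Nn].
  move/(deviation_le _ _ _ _ _ _ fap_mu (mu0 ^~ n) mA (determined_by_le _ _ _ Nn EN)).
  by case; [left|right; exists n].
apply: le_trans (fap_leU fap_mu _ _ mY mX) _.
have := maximal_inequality e (ltW e0) mu _ mY.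
rewrite mulrC -ler_pdivlMr// => maxe.
apply: le_trans (lerD (lexx _) maxe) _.
by rewrite -[X in X + _]mulr1 -mulrDr -ler_pdivlMr// ltW.
Qed.

(** * Posteriors of the ultrafilter mixture *)

Lemma singleton_bigcap_cylinder (w : Omega) : [set w] = \bigcap_n cylinder w n.
Proof.
apply/seteqP; split=> [v -> n _|v vP]; first exact: cylinder_refl.
by apply/funext => i; exact: (vP i.+1 I i (ltnSn i)).
Qed.

Lemma measurable_singleton (w : Omega) : measurable [set w].
Proof.
rewrite singleton_bigcap_cylinder; apply: bigcap_measurable => // n _.
exact: measurable_cylinder.
Qed.

Lemma zero_path_cylinder (k n : nat) :
  cylinder zero_path n (unit_path k) = (n <= k)%N.
Proof.
rewrite propeqE; split=> [dk|nk i lin]; last first.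
  by rewrite /unit_path /zero_path ltn_eqF//; exact: leq_trans nk.
rewrite leqNgt; apply/negP => /dk.
by rewrite /unit_path eqxx.
Qed.

Section ultrafilter_mixture.
Context {R : realType} {V : set_system nat} {mu0 : probability Omega R}.
Context {alpha : R}.
Hypothesis hV : free_ultrafilter V.
Hypothesis hmu0 : mu0 [set zero_path] = 0%E.
Hypothesis halpha : 0 < alpha < 1.
Hypothesis hpos : forall (w : Omega) (n : nat), (1 <= n)%N ->
  0 < mixture alpha V mu0 (cylinder w n).

Let UV : UltraFilter V := hV.1.
Let p := real_prob mu0.
Let P := mixture alpha V mu0.
Let a0 : 0 < alpha. Proof. by case/andP: halpha. Qed.
Let a1 : 0 < 1 - alpha. Proof. by case/andP: halpha; rewrite subr_gt0. Qed.
Let fap_p : finitely_additive_probability p := real_prob_fap R mu0.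
Let fap_u : finitely_additive_probability (ultra_prob R V) :=
  ultra_prob_fap R UV.

Let PE (A : set Omega) : P A = alpha * ultra_prob R V A + (1 - alpha) * p A.
Proof. by []. Qed.

(** A bounded set of indices is finite, hence not in the free ultrafilter. The case [n = 0] covers
    sets without unit paths. *)
Lemma ultra_prob_bounded (A : set Omega) (n : nat) :
  (forall k, A (unit_path k) -> (k < n)%N) -> ultra_prob R V A = 0.
Proof.
move=> An; rewrite /ultra_prob; case: asboolP => // VA.
by case: (hV.2 _ _ VA); apply: sub_finite_set (finite_II n).
Qed.

Lemma ultra_prob_zero_path (n : nat) :
  ultra_prob R V (cylinder zero_path n) = 1.
Proof.
have [_ uD u1] := fap_u.
have mC := measurable_cylinder zero_path n.
have := uD _ _ mC (measurableC mC) (setICr _).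
rewrite setUCr u1 [X in _ = _ + X](ultra_prob_bounded _ n) ?addr0// => k.
by rewrite /= zero_path_cylinder => /negP; rewrite -ltnNge.
Qed.

(** Once a cylinder fixes a [1] at index [i], the only unit path it can contain is [unit_path i]. *)
Lemma ultra_prob_cylinder (A : set Omega) (w : Omega) (i n : nat) :
  w i -> (i < n)%N -> ultra_prob R V (A `&` cylinder w n) = 0.
Proof.
move=> wi lin; apply: (ultra_prob_bounded _ i.+1) => k [_ /(_ i lin)].
by rewrite wi /unit_path => /eqP ->.
Qed.

(** The ultrafilter term vanishes in numerator and denominator, and the factor [1 - alpha]
    cancels. *)
Lemma mixture_posterior (A : set Omega) (w : Omega) (i n : nat) :
  w i -> (i < n)%N -> posterior P A n w = posterior p A n w.
Proof.
move=> wi lin; rewrite /posterior !PE -[cylinder w n in X in _ / X]setTI.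
rewrite !(ultra_prob_cylinder _ _ i _ wi lin)// !mulr0 !add0r setTI.
by rewrite -mulf_div divff ?mul1r// gt_eqF.
Qed.

(** Positivity of the mixture could come from the ultrafilter term alone, so it is used on the
    smaller cylinder whose next coordinate is [1], where that term is [0]. *)
Lemma real_prob_cylinder_gt0 (w : Omega) (n : nat) : 0 < p (cylinder w n).
Proof.
pose v := fork w n true; have vn : v n by rewrite /v /fork eqxx.
have := hpos v n.+1 isT.
rewrite -[mixture _ _ _ _]/(P _) PE -[X in ultra_prob _ _ X]setTI.
rewrite (ultra_prob_cylinder _ _ n _ vn)// mulr0 add0r pmulr_rgt0// => v0.
apply: lt_le_trans v0 _; rewrite (fap_le fap_p)//.
- exact: measurable_cylinder.
- exact: measurable_cylinder.
- by move=> u uv; rewrite cylinder_fork; left.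
Qed.

Lemma mixture_posterior_cvg (A : set Omega) (w : Omega) :
  w <> zero_path ->
  posterior p A n w @[n --> \oo] --> (\1_A w : R) ->
  posterior P A n w @[n --> \oo] --> (\1_A w : R).
Proof.
move=> wz; have [i wi] : exists i, w i.
  apply: contrapT => /forallNP w0; apply: wz; apply/funext => i.
  by apply/negbTE/negP; exact: w0.
apply: cvg_trans; apply: near_eq_cvg; near=> n.
by rewrite (mixture_posterior _ _ i)//; near: n; exists i.+1.
Unshelve. all: by end_near.
Qed.

(* [z] never lies in a stage [D_n] for [A = [z|m] \ {d_k}], so no [D_n] is
   charged by [u_V] and, by CHT, neither is their union. But if [d_k] is null,
   then its posterior of [A] is [1] at stage [k.+1]. *)
Lemma CHT_unit_path_gt0 : CHT_property P ->
  V [set k | 0 < p [set unit_path k]].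
Proof.
move=> hCHT; have UltraV : UltraFilter V := UV.
(* The cylinders around [z] shrink to a null point; [alpha / 2] is chosen to match the threshold
   [2^-1]. *)
have [m zm] : exists m, (1 - alpha) * p (cylinder zero_path m) <= alpha / 2.
  have : (1 - alpha) * p (cylinder zero_path n) @[n --> \oo] --> (0 : R).
    have -> : (0 : R) = (1 - alpha) * p (\bigcap_n cylinder zero_path n).
      by rewrite -singleton_bigcap_cylinder /p /real_prob hmu0 mulr0.
    apply: cvgMr; apply: real_prob_nonincreasing => [n|i j ij].
      exact: measurable_cylinder.
    exact: cylinder_le.
  move=> /cvgr_le /(_ (alpha / 2)) [|m _ /(_ m (leqnn m))]; first by rewrite divr_gt0.
  by exists m.
pose D := range unit_path; pose A := cylinder zero_path m `\` D.
have mD : measurable D.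
  rewrite (_ : D = \bigcup_k [set unit_path k]).
    by apply: bigcup_measurable => k _; exact: measurable_singleton.
  by apply/seteqP; split => w [k _]; [move=> <-|move=> ->]; exists k.
have mA : measurable A by apply: measurableD => //; exact: measurable_cylinder.
have uA X : ultra_prob R V (A `&` X) = 0.
  by apply: (ultra_prob_bounded _ 0) => k [[_ []]]; exists k.
(* [A] contains no unit path, so the numerator is at most [alpha / 2] by the choice of [m], while
   every cylinder around [z] has [P]-probability at least [alpha]. *)
have zA n : ~ exceed P A 2^-1 n zero_path.
  have z0 : 0 < P (cylinder zero_path n).
    rewrite PE ultra_prob_zero_path mulr1 ltr_pwDl// mulr_ge0 ?ltW//.
    exact: real_prob_cylinder_gt0.
  rewrite /exceed /posterior /= ltr_pdivlMr//; apply/negP; rewrite -leNgt.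
  rewrite PE uA mulr0 add0r; apply: le_trans (_ : alpha / 2 <= _).
    apply: le_trans zm; rewrite ler_pM2l// (fap_le fap_p)//.
    - by apply: measurableI => //; exact: measurable_cylinder.
    - exact: measurable_cylinder.
    - by move=> w [[]].
  rewrite mulrC ler_pM2l ?invr_gt0// PE ultra_prob_zero_path mulr1 lerDl.
  by rewrite mulr_ge0 ?ltW// real_prob_cylinder_gt0.
pose F n := first_exceed P A 2^-1 n.
have mF n : measurable (F n).
  apply: measurableD; first exact: measurable_exceed.
  by apply: bigcup_measurable => j _; exact: measurable_exceed.
(* For [n <= k], [unit_path k] shares its cylinder of length [n], hence its posterior, with [z]; by
   [zA] only indices [k < n] can occur. *)
have uF n : ultra_prob R V (F n) = 0.
  apply: (ultra_prob_bounded _ n) => k [kn _]; rewrite ltnNge; apply/negP.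
  rewrite -zero_path_cylinder => /cylinder_eq zk; apply: (zA n); move: kn.
  by rewrite /exceed /posterior /= zk.
have tF : trivIset setT (fun n => F n.+1).
  apply: ltn_trivIset => j i ij; apply/seteqP; split => // w [[wi _] [_]].
  by apply; exists i.+1.
have UFE : \bigcup_(n in [set n | (1 <= n)%N]) F n = \bigcup_n F n.+1.
  apply/seteqP; split=> w [n]; last by exists n.+1.
  by case: n => // n _ wn; exists n.
have uUF : ultra_prob R V (\bigcup_n F n.+1) = 0.
  have := hCHT A 2^-1 mA; rewrite invr_gt0 ltr0n invf_lt1// ltr1n => /(_ isT).
  rewrite -/F UFE => sumP.
  (* The stages carry only [mu0]-mass, which is countably additive. Comparison with the limit given
     by CHT leaves no ultrafilter mass for the union. *)
  have sump : (\sum_(1 <= n < N.+1) P (F n)) @[N --> \oo] -->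
      (1 - alpha) * p (\bigcup_n F n.+1).
    rewrite (_ : (fun N => _) =
        (fun N => (1 - alpha) * \sum_(0 <= n < N) p (F n.+1))).
      by apply: cvgMr; exact: real_prob_sigma_additive.
    apply/funext => N; rewrite big_add1 mulr_sumr; apply: eq_bigr => n _.
    by rewrite PE uF mulr0 add0r.
  have hR := @norm_hausdorff R R.
  have /eqP : P (\bigcup_n F n.+1) = (1 - alpha) * p (\bigcup_n F n.+1).
    by rewrite -(cvg_lim hR sumP) -(cvg_lim hR sump).
  by rewrite PE -subr_eq0 addrK mulf_eq0 gt_eqF//= => /eqP.
have VnF : V [set k | ~ (\bigcup_n F n.+1) (unit_path k)].
  have [VF|//] := in_ultra_setVsetC [set k | (\bigcup_n F n.+1) (unit_path k)] UV.
  move: uUF; rewrite /ultra_prob; case: asboolP => // _ /eqP.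
  by rewrite oner_eq0.
have Vm : V [set k | (m <= k)%N].
  have := ultra_prob_zero_path m; rewrite /ultra_prob; case: asboolP.
    by move=> + _; apply: filterS => k /=; rewrite zero_path_cylinder.
  by move=> _ /esym/eqP; rewrite oner_eq0.
apply: filterS (filterI VnF Vm) => k [kF mk] /=.
have mdk := measurable_singleton (unit_path k).
rewrite lt0r (fap_ge0 fap_p)// andbT; apply/eqP => pk0; apply: kF.
have mC := measurable_cylinder (unit_path k) k.+1.
have dkA : exceed P A 2^-1 k.+1 (unit_path k).
  have dk : unit_path k k by rewrite /unit_path.
  rewrite /exceed /= (mixture_posterior _ _ k)// /posterior.
  (* Since [m <= k], this cylinder lies in [cylinder zero_path m], and its only unit path is
     [unit_path k]. Removing that null point leaves posterior [1]. *)
  rewrite (_ : A `&` _ = cylinder (unit_path k) k.+1 `\` [set unit_path k]).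
    have := fap_setDI fap_p _ _ mC mdk.
    rewrite (setIidr (_ : [set unit_path k] `<=` _)) ?pk0 ?add0r//.
    move=> <-; rewrite divff ?invf_lt1 ?ltr1n// gt_eqF//.
      exact: real_prob_cylinder_gt0.
    by move=> _ ->; exact: cylinder_refl.
  apply/seteqP; split=> w.
    by move=> [[_ nDw] kw]; split => // wk; apply: nDw; exists k.
  move=> [kw wk]; split => //; split.
    move=> i im; rewrite (kw i (leq_trans im (leqW mk))).
    by rewrite /unit_path /zero_path ltn_eqF//; exact: leq_trans mk.
  move=> [j _ jw]; apply: wk; rewrite -jw; congr unit_path.
  have := kw k (ltnSn k); rewrite -jw /unit_path eqxx.
  by move=> /eqP.
(* The least positive stage [n.+1] above the threshold puts [unit_path k] in [F n.+1], contrary to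
   the choice of [k]. *)
pose Q n := `[< exceed P A 2^-1 n.+1 (unit_path k) >].
have exQ : exists n, Q n by exists k; apply/asboolP.
case: (ex_minnP exQ) => n /asboolP nk nmin; exists n => //; split => //.
move=> [[|j]] //= jn jk; have := nmin j; rewrite /Q => /(_ (asboolT jk)).
by rewrite leqNgt -ltnS jn.
Qed.

End ultrafilter_mixture.

Theorem proposition6p7 (R : realType) (V : set_system nat)
    (mu0 : probability Omega R) (alpha : R)
    (hV : free_ultrafilter V)
    (hmu0 : mu0 [set zero_path] = 0%E)
    (halpha : 0 < alpha < 1)
    (hpos : forall (w : Omega) (n : nat), (1 <= n)%N ->
      0 < mixture alpha V mu0 (cylinder w n))
    (hCHT : CHT_property (mixture alpha V mu0)) :
  forall A : set Omega, measurable A ->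
    posteriors_converge_as (mixture alpha V mu0) A.
Proof.
move=> A mA; rewrite /posteriors_converge_as; set P := mixture alpha V mu0.
set C := [set w | _]; have mC : measurable C by exact: measurable_posterior_cvg.
pose C0 := [set w | posterior (real_prob mu0) A n w @[n --> \oo] --> (\1_A w : R)].
have mC0 : measurable C0 by exact: measurable_posterior_cvg.
have p0 := real_prob_cylinder_gt0 hV halpha hpos.
have C00 : mu0 (~` C0) = 0%E by exact: posterior_cvg_ae.
have C0C w : w <> zero_path -> C0 w -> C w.
  by move=> wz; exact: mixture_posterior_cvg.
have muC : mu0 C = 1%E.
  (* Convergence passes from [mu0] to the mixture at every path other than [z], and [z] is null. *)
  have nC : mu0 (~` C) = 0%E.
    apply: measure_negligible; first exact: measurableC.
    exists (~` C0 `|` [set zero_path]); split.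
    - by apply: measurableU; [exact: measurableC|exact: measurable_singleton].
    - apply: null_set_setU => //; first exact: measurableC.
      exact: measurable_singleton.
    - move=> w nCw; have [->|wz] := pselect (w = zero_path); first by right.
      by left => C0w; apply/nCw/C0C.
  by rewrite -(setCK C) probability_setC ?nC ?sube0//; exact: measurableC.
have uC : ultra_prob R V C = 1.
  have UV := hV.1.
  rewrite /ultra_prob; case: asboolP => // -[].
  apply: filterS (CHT_unit_path_gt0 hV hmu0 halpha hpos hCHT) => k /= k0.
  apply: C0C => [/(congr1 (fun w : Omega => w k))|].
    by rewrite /unit_path /zero_path eqxx.
  (* An atom of [mu0] cannot lie in the null set where Levy's law fails. *)
  apply: contrapT => nC0; move: k0; rewrite ltNge => /negP; apply.
  rewrite -[0]/(fine 0) -C00; apply: (fap_le (real_prob_fap R mu0)).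
  - exact: measurable_singleton.
  - exact: measurableC.
  - by move=> _ ->.
by rewrite /P /mixture uC muC !mulr1 addrC subrK.
Qed.
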